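(* Let $n\geq 2$, $k\geq 1$ and $l\geq 1$ be integers. Then $$f_{k,l}(n)\log n = \sum_{\substack{d^i\mid n\\ d\geq 2}}\ \sum_{j=1}^{l}(-1)^{j+1}\binom{i}{j}\, f_{k-i,\,l-j}(n/d^i)\,\log d,$$ $$h_l(n)\log n = \sum_{\substack{d^i\mid n\\ d\geq 2}}\ \sum_{j=1}^{l}(-1)^{j+1}\binom{i}{j}\, h_{l-j}(n/d^i)\,\log d,$$ where the outer sums run over all pairs $(d,i)$ of integers with $d\geq 2$, $i\geq 1$ and $d^i\mid n$, and where the boundary values (the cases $n=1$, $k\leq 0$ or $l\leq 0$ for $f_{k,l}(n)$, and $n=1$ or $l=0$ for $h_l(n)$) are $$f_{k,l}(n)=\begin{cases}1,&\text{if } n=1 \text{ and } k=l=0;\\ 0,&\text{otherwise,}\end{cases}\qquad h_l(n)=\begin{cases}1,&\text{if } n=1\text{ and } l=0;\\ 0,&\text{otherwise.}\end{cases}$$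
   Context: A factorization of $n$ is unordered: it is a finite multiset of integers (its parts) whose product is $n$. For $n\geq 2$ and $k,l\geq 1$: - $f_{k,l}(n)$ denotes the number of factorizations of $n$ into exactly $k$ parts $\geq 2$ (counted with multiplicity) among which exactly $l$ different part values occur; for example, $f_{3,2}(36)=2$, counting $(9,2,2)$ and $(3,3,4)$. - $h_l(n)$ denotes the number of factorizations of $n$ into parts $\geq 2$ (any number of parts) in which exactly $l$ different part values occur. The binomial coefficient $\binom{i}{j}$ is $0$ for $j>i$. *)

(* Defs.v *)
From HB Require Import structures.
From mathcomp Require Import all_boot all_order all_algebra.
From mathcomp Require Import finmap multiset.
From mathcomp Require Import all_classical all_reals all_analysis.

Set Implicit Arguments.
Unset Strict Implicit.
Unset Printing Implicit Defensive.

Import Order.TTheory GRing.Theory Num.Theory.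

Local Open Scope mset_scope.
Local Open Scope classical_set_scope.
Local Open Scope nat_scope.

(* A [{mset nat}] coerces to the sequence listing its elements with
   multiplicity, so the product below is over the parts with multiplicity. *)
Definition factorizations (n : nat) : set {mset nat} :=
  [set m : {mset nat} |
    (forall d, d \in m -> 2 <= d) /\ \prod_(d <- m) d = n].

Definition nb_parts (m : {mset nat}) : nat := size m.

Definition nb_values (m : {mset nat}) : nat := #|` finsupp m |.

(* [fset_set] sends infinite sets to [fset0]; this shows that the junk value is
   never used below. *)
Lemma finite_factorizations (n : nat) :
  0 < n -> finite_set (factorizations n).
Proof.
move=> n0.
pose g (b : n.-bseq 'I_n.+1) : {mset nat} := seq_mset (map val b).
apply: (@sub_finite_set _ _ (g @` setT)); last first.
  exact/finite_image/finite_finset.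
move=> m [m2 mn].
have dn d : d \in m -> d < n.+1.
  move=> dm; rewrite ltnS dvdn_leq// -mn.
  by rewrite (big_rem d dm)/= dvdn_mulr.
have sz : size [seq inord d : 'I_n.+1 | d <- m] <= n.
  rewrite size_map -[leqRHS]mn.
  apply: (@leq_trans (2 ^ size m)); first exact/ltnW/ltn_expl.
  have : forall d, d \in (m : seq nat) -> 2 <= d by exact: m2.
  elim: (m : seq nat) => [|a s IH] ms; first by rewrite big_nil.
  rewrite big_cons expnS leq_mul ?ms ?mem_head//.
  by apply: IH => d ds; rewrite ms// inE ds orbT.
exists (Bseq sz) => //; rewrite /g /= -map_comp.
rewrite (_ : map _ _ = m :> seq nat); last first.
  by rewrite -[RHS]map_id; apply/eq_in_map => d dm /=; rewrite inordK// dn.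
exact: seq_mset_id.
Qed.

(* The first index is an [int] because the recurrence evaluates it at [k - i],
   which may be negative. *)
Definition f (k l : int) (n : nat) : nat :=
  if [&& 2 <= n, (1 <= k)%R & (1 <= l)%R] then
    #|` fset_set [set m | [/\ factorizations n m,
                              (nb_parts m)%:Z%R = k & (nb_values m)%:Z%R = l]] |
  else ((n == 1) && (k == 0%R) && (l == 0%R) : nat).

Definition h (l n : nat) : nat :=
  if (2 <= n) && (1 <= l) then
    #|` fset_set [set m | factorizations n m /\ nb_values m = l] |
  else ((n == 1) && (l == 0) : nat).

(* Main.v *)
Require Import Defs.
From mathcomp Require Import all_boot all_order all_algebra.
From mathcomp Require Import finmap multiset.
From mathcomp Require Import all_classical all_reals all_analysis.
From mathcomp Require Import zify.

Import Order.TTheory GRing.Theory Num.Theory.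

Local Open Scope mset_scope.
Local Open Scope ring_scope.

(** Write v(m) for the number of different parts of a factorization m and m(d)
for the multiplicity of the part d in it.

For a factorization m of n, log n is the sum of m(d) log d over d >= 2
([ln_factorization]), so the left-hand sides become the sum over d of log d
times the total multiplicity of d in the factorizations that are counted. It
then suffices to compare the coefficients of log d for each fixed d.

On the right-hand side, adjoining i copies of d turns the factorizations m' of
n / d^i into exactly the factorizations m of n with m(d) >= i
([big_factorization_fset_div]). In these terms v(m') = v(m) - 1 if i = m(d) and
v(m') = v(m) if i < m(d), because the part d is lost only when all its copies
are removed ([nb_values_msetB_msetn]). After exchanging the sums, a single m
with v = v(m) and b = m(d) contributes
  sum_(1 <= i <= b) sum_(1 <= j <= l) (-1)^(j+1) 'C(i, j) [v - [i = b] = l - j].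
The inner sum has at most one nonzero term. If v > l there is none at all; if
v = l only i = b and j = 1 contribute, and they give b; if v < l then, with
t = l - v, the indices i < b give (-1)^(t+1) times the sum of the 'C(i, t),
that is (-1)^(t+1) 'C(b, t+1) by the hockey-stick identity, and i = b gives
(-1)^(t+2) 'C(b, t+1), which cancels it ([sum_bin_multiplicity]). So m
contributes its multiplicity m(d) if v(m) = l and 0 otherwise, which is the
coefficient on the left-hand side.

The number of parts takes part in this argument only through its growth by i
when i copies of d are adjoined. Both recurrences are therefore instances of
one ([count_factorization_ln]), in which the number of parts is subject to an
arbitrary predicate. *)

(** * Removing copies of one element from a multiset *)

Lemma perm_msetD (K : choiceType) (A B : {mset K}) :
  perm_eq (A `+` B : {mset K}) ((A : seq K) ++ (B : seq K)).
Proof. by apply/allP => a _ /=; rewrite count_cat !count_mem_mset msetE2. Qed.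

Lemma prod_msetD_msetn (A : {mset nat}) i d :
  (\prod_(x <- A `+` msetn i d : {mset nat}) x = (\prod_(x <- A) x) * d ^ i)%N.
Proof.
rewrite (perm_big _ (perm_msetD _ A (msetn i d))) big_cat/= enum_msetn.
by rewrite big_nseq iter_muln_1.
Qed.

Lemma nb_parts_msetD_msetn (A : {mset nat}) i d :
  nb_parts (A `+` msetn i d) = (nb_parts A + i)%N.
Proof.
by rewrite /nb_parts (perm_size (perm_msetD _ A (msetn i d))) size_cat
  enum_msetn size_nseq.
Qed.

Lemma msub_msetn (K : choiceType) i (d : K) (A : {mset K}) :
  msubset (msetn i d) A = (i <= A d)%N.
Proof.
apply/msubsetP/idP => [/(_ d)|iA x]; first by rewrite msetnxx.
by rewrite msetnE; case: eqP => [->|].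
Qed.

Lemma nb_values_msetB_msetn (A : {mset nat}) i d :
  (0 < i <= A d)%N ->
  nb_values (A `\` msetn i d) = (nb_values A - (i == A d))%N.
Proof.
move=> /andP[i0 iA].
have dA : d \in finsupp A by rewrite msuppE in_mset (leq_trans i0).
rewrite /nb_values; have [iAd|iAd] := eqVneq i (A d).
  rewrite (cardfsD1 d (finsupp A)) dA addKn; congr (#|` _|).
  apply/fsetP => x; rewrite !inE !msuppE !in_mset !msetE2 msetnE.
  by case: eqP => [->|]; rewrite ?iAd ?subnn ?subn0.
rewrite subn0; congr (#|` _|).
apply/fsetP => x; rewrite !msuppE !in_mset !msetE2 msetnE.
case: eqP => [->|]; rewrite ?subn0// subn_gt0 ltn_neqAle iAd iA.
by rewrite (leq_trans i0 iA).
Qed.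

Lemma nb_parts_eq0 (A : {mset nat}) : nb_parts A = 0%N -> A = mset0.
Proof. by move=> /eqP; rewrite /nb_parts size_mset_eq0 => /eqP. Qed.

Lemma nb_values_eq0 (A : {mset nat}) : nb_values A = 0%N -> A = mset0.
Proof.
move=> /eqP; rewrite /nb_values cardfs_eq0 => /eqP A0; apply/msetP => x.
by rewrite mset0E; apply/eqP; rewrite -memNfinsupp A0 inE.
Qed.

(** * Factorizations of n and of n / d^i *)

Definition factorization_fset (n : nat) : {fset {mset nat}} :=
  fset_set (factorizations n).

Lemma factorization_fsetP n (m : {mset nat}) : (0 < n)%N ->
  reflect (factorizations n m) (m \in factorization_fset n).
Proof.
move=> n0; rewrite in_fset_set; last exact: finite_factorizations.
by apply: (iffP idP) => [/set_mem|/mem_set].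
Qed.

Lemma factorizations_mset0 n : factorizations n mset0 -> n = 1%N.
Proof. by case=> _ <-; rewrite big_mset0. Qed.

Lemma factorizations1 (m : {mset nat}) : factorizations 1 m <-> m = mset0.
Proof.
split=> [[m2 m1]|->]; last by split=> [d|]; rewrite ?in_mset0 ?big_mset0.
apply/msetP => x; rewrite mset0E; apply/mset_eq0P/negP => xm.
move/eqP: m1; rewrite (big_rem x xm)/= muln_eq1 => /andP[/eqP x1 _].
by have := m2 x xm; rewrite x1.
Qed.

Lemma factorizations_exp_dvd n (m : {mset nat}) d :
  factorizations n m -> (d ^ m d %| n)%N.
Proof.
case=> _ <-; rewrite -{2}(@msetBDK _ (msetn (m d) d) m) ?msub_msetn//.
by rewrite prod_msetD_msetn dvdn_mull.
Qed.

Lemma factorizations_msetD n (m : {mset nat}) i d :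
  (0 < i)%N -> (2 <= d)%N -> (d ^ i %| n)%N ->
  factorizations n (m `+` msetn i d) <-> factorizations (n %/ d ^ i) m.
Proof.
move=> i0 d2 dn; have di0 : (0 < d ^ i)%N by rewrite expn_gt0 (leq_trans _ d2).
rewrite /factorizations/= prod_msetD_msetn; split=> -[m2 mn]; split.
- by move=> x xm; apply: m2; rewrite in_msetD xm.
- by rewrite -mn mulnK.
- by move=> x; rewrite in_msetD in_msetn i0 /= => /orP[/m2//|/eqP->].
- by rewrite mn divnK.
Qed.

(** Adjoining i copies of d is injective, and removing them again undoes it as
soon as d has multiplicity at least i: this is the bijection that brings every
term of the recurrence back to factorizations of n itself. *)
Lemma big_factorization_fset_div (V : nmodType) (G : {mset nat} -> V) n i d :
  (0 < n)%N -> (0 < i)%N -> (2 <= d)%N -> (d ^ i %| n)%N ->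
  \sum_(m <- factorization_fset (n %/ d ^ i)) G (m `+` msetn i d) =
  \sum_(m <- factorization_fset n | (i <= m d)%N) G m.
Proof.
move=> n0 i0 d2 dn.
have q0 : (0 < n %/ d ^ i)%N.
  by rewrite divn_gt0 ?expn_gt0 ?(leq_trans _ d2)// dvdn_leq.
transitivity
    (\sum_(m <- [fset m `+` msetn i d | m in factorization_fset (n %/ d ^ i)]%fset) G m).
  rewrite big_imfset//= => A B _ _ AB.
  exact: can_inj (msetDKBC (msetn i d)) _ _ AB.
rewrite [RHS]big_fset_condE; apply: eq_fbigl => m.
rewrite !inE/=; apply: esym; apply/andP/imfsetP => /=.
- move=> [/factorization_fsetP-/(_ n0) mn im]; exists (m `\` msetn i d); last first.
    by rewrite msetBDK ?msub_msetn.
  by apply/factorization_fsetP => //; apply/factorizations_msetD; rewrite ?msetBDK ?msub_msetn.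
- move=> [m' /factorization_fsetP-/(_ q0) m'q ->]; split.
    by apply/factorization_fsetP => //; apply/factorizations_msetD.
  by rewrite msetE2 msetnxx leq_addl.
Qed.

(** The logarithm turns the product of the parts into a sum, in which equal parts
are then grouped. *)
Lemma ln_factorization (R : realType) n (m : {mset nat}) :
  (0 < n)%N -> factorizations n m ->
  ln (n%:R : R) = \sum_(2 <= d < n.+1) (m d)%:R * ln d%:R.
Proof.
move=> n0 [m2 mn].
have mle x : x \in (m : seq nat) -> (2 <= x < n.+1)%N.
  move=> xm; rewrite m2//= ltnS dvdn_leq// -mn (big_rem x xm)/=.
  exact: dvdn_mulr.
have -> : ln n%:R = \sum_(x <- m) ln x%:R :> R.
  rewrite -mn; elim: (m : seq nat) mle => [|a s IH] sle.
    by rewrite !big_nil ln1.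
  have s2 x : x \in a :: s -> (0 < x)%N by move=> /sle/andP[/ltnW].
  rewrite !big_cons natrM lnM ?IH//.
  - by move=> x xs; apply: sle; rewrite inE xs orbT.
  - by rewrite posrE ltr0n s2// mem_head.
  rewrite posrE ltr0n big_seq_cond prodn_cond_gt0// => x /andP[xs _].
  by rewrite s2// inE xs orbT.
transitivity (\sum_(x <- m) \sum_(2 <= d < n.+1 | d == x) ln d%:R : R).
  apply: eq_big_seq => x /mle xn.
  rewrite -big_filter (_ : [seq _ <- _ | _] = [:: x]) ?big_seq1//.
  by rewrite (@filter_pred1_uniq _ _ x) ?iota_uniq// mem_index_iota.
rewrite (exchange_big_dep predT)//=; apply: eq_bigr => d _.
rewrite big_const_seq iter_addr_0 mulr_natl -count_mem_mset.
by congr (_ *+ _); apply: eq_count => x; rewrite /= eq_sym.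
Qed.

(** * Counting by number of parts and of values *)

(** The number of parts is subject to a predicate rather than fixed, so that the
same count covers f (a prescribed number of parts) and h (no condition). *)
Definition count_factorization (P : pred nat) (l n : nat) : nat :=
  \sum_(m <- factorization_fset n) (P (nb_parts m) && (nb_values m == l)).

Lemma card_fset_set_factorizations n (Q : pred {mset nat}) : (0 < n)%N ->
  (#|` fset_set [set m | factorizations n m /\ Q m]| =
   \sum_(m <- factorization_fset n) Q m)%N.
Proof.
move=> n0; have -> : (\sum_(m <- factorization_fset n) Q m =
    \sum_(m <- factorization_fset n | Q m) 1)%N.
  by rewrite [RHS]big_mkcond; apply: eq_bigr => m _; case: (Q m).
rewrite card_fset_sum1 [RHS]big_fset_condE; apply: eq_fbigl => m.
rewrite in_fset_set; last first.
  by apply: sub_finite_set (@finite_factorizations n n0) => x [].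
rewrite !inE/=; apply/idP/andP => [/set_mem[mn Qm]|[/factorization_fsetP-/(_ n0) mn Qm]].
  by split=> //; apply/factorization_fsetP.
exact/mem_set.
Qed.

Lemma count_factorization1 P l : count_factorization P l 1 = (P 0%N && (l == 0%N)).
Proof.
rewrite /count_factorization.
rewrite (_ : factorization_fset 1 = [fset mset0]%fset); last first.
  by rewrite /factorization_fset (_ : factorizations 1 = [set mset0]%classic)
    ?fset_set1//; apply/seteqP; split=> m /factorizations1.
rewrite big_seq_fset1 /nb_parts /nb_values enum_mset0 finsupp0 cardfs0.
by rewrite [in RHS]eq_sym.
Qed.

Lemma count_factorization_eq0 P l n : (2 <= n)%N ->
  (forall m : {mset nat}, m != mset0 ->
    ~~ (P (nb_parts m) && (nb_values m == l))) ->
  count_factorization P l n = 0%N.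
Proof.
move=> n2 Pl; rewrite /count_factorization big_seq big1// => m.
move=> /factorization_fsetP-/(_ (ltnW n2)) mn.
have /Pl/negbTE-> // : m != mset0.
by apply: contraTneq n2 => m0; move: mn; rewrite m0 => /factorizations_mset0->.
Qed.

(** The boundary values in the definition of f are what counting factorizations
gives anyway: the only factorization of 1 is the empty one, and a factorization
of n >= 2 has at least one part and one value. *)
Lemma f_count_factorization (k : int) (l n : nat) : (0 < n)%N ->
  f k l%:Z n = count_factorization (fun s => s%:Z == k) l n.
Proof.
move=> n0; rewrite /f; case: ifPn => [/and3P[n2 k1 l1]|].
  rewrite /count_factorization -card_fset_set_factorizations//; congr (#|` fset_set _|).
  apply/seteqP; split=> m /=.
    by move=> [mn -> vl]; split=> //; rewrite eqxx/= -eqz_nat vl.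
  by move=> [mn /andP[/eqP<- /eqP<-]].
move=> H; have [->|n1] := eqVneq n 1%N.
  by rewrite count_factorization1/= eqz_nat [k == 0]eq_sym.
have n2 : (2 <= n)%N by lia.
rewrite count_factorization_eq0// => m m0; apply/negP => /andP[/eqP km /eqP lm].
have p0 : nb_parts m <> 0%N by move/nb_parts_eq0 => mE; rewrite mE eqxx in m0.
have v0 : nb_values m <> 0%N by move/nb_values_eq0 => mE; rewrite mE eqxx in m0.
by lia.
Qed.

Lemma h_count_factorization (l n : nat) : (0 < n)%N ->
  h l n = count_factorization xpredT l n.
Proof.
move=> n0; rewrite /h; case: ifPn => [/andP[n2 l1]|H].
  rewrite /count_factorization -card_fset_set_factorizations//; congr (#|` fset_set _|).
  by apply/seteqP; split=> m /= [mn /eqP].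
have [->|n1] := eqVneq n 1%N; first by rewrite count_factorization1.
rewrite count_factorization_eq0//; first by lia.
move=> m m0; apply/eqP => lm.
have v0 : nb_values m <> 0%N by move/nb_values_eq0 => mE; rewrite mE eqxx in m0.
by lia.
Qed.

(** * The alternating binomial identity *)

(** The hockey-stick identity. *)
Lemma sum_bin_col b t : (\sum_(0 <= i < b) 'C(i, t) = 'C(b, t.+1))%N.
Proof.
elim: b => [|b IH]; first by rewrite big_geq.
by rewrite big_nat_recr//= IH binS addnC.
Qed.

(** The condition w = l - j selects j = l - w, which lies between 1 and l exactly
when w < l; the guard matters since l - w is a truncated subtraction. *)
Lemma sum_bin_pick (V : pzRingType) l i w :
  \sum_(1 <= j < l.+1) (-1) ^+ j.+1 * 'C(i, j)%:R * (w == l - j)%N%:R =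
  if (w < l)%N then (-1) ^+ (l - w).+1 * 'C(i, l - w)%:R else 0 :> V.
Proof.
case: ifPn => wl; last first.
  rewrite big_nat big1// => j jl; rewrite (_ : (w == _) = false) ?mulr0//; lia.
rewrite (bigD1_seq (l - w)%N)/= ?iota_uniq ?mem_index_iota//; last by lia.
rewrite (_ : w == _) ?mulr1; last by lia.
rewrite big_nat_cond big1 ?addr0// => j jl.
by rewrite (_ : (w == _) = false) ?mulr0//; lia.
Qed.

(** The contribution of one factorization with v values, in which the part at
hand has multiplicity b. For v < l the term i = b cancels the sum of all the
others by the hockey-stick identity; for v = l it alone survives. *)
Lemma sum_bin_multiplicity (V : pzRingType) l v b : (0 < v)%N -> (0 < l)%N ->
  \sum_(1 <= i < b.+1) \sum_(1 <= j < l.+1)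
    (-1) ^+ j.+1 * 'C(i, j)%:R * (v - (i == b) == l - j)%N%:R =
  b%:R * (v == l)%:R :> V.
Proof.
move=> v0 l0; case: b => [|b]; first by rewrite big_geq// mul0r.
under eq_bigr do rewrite sum_bin_pick.
rewrite big_nat_recr//= eqxx.
rewrite (eq_big_nat _ _ (F2 := fun i => if (v < l)%N then
    (-1) ^+ (l - v).+1 * 'C(i, l - v)%:R else 0 : V)); last first.
  by move=> i ib; rewrite (_ : (i == b.+1) = false) ?subn0//; lia.
have [vl|lv|->] := ltngtP v l.
- rewrite ifT; last by lia.
  (* The hockey-stick sum starts at 0, whose term 'C(0, l - v) vanishes. *)
  rewrite (_ : l - (v - true) = (l - v).+1)%N; last by lia.
  rewrite -mulr_sumr -natr_sum -sum_bin_col [X in _ + _ * X%:R]big_ltn//.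
  rewrite bin0n (_ : (l - v == 0)%N = false) ?add0n; last by lia.
  by rewrite -mulrDl [_ ^+ _.+2]exprSr mulrN1 addrN mul0r mulr0.
- by rewrite big1// ifF ?addr0 ?mulr0//; lia.
rewrite big1// ifT ?subn1; last by lia.
by rewrite (_ : l - l.-1 = 1)%N ?bin1 ?expr2 ?mulrNN ?mul1r ?add0r ?mulr1//; lia.
Qed.

(** The coefficient of log d: the right-hand side adds up to the total
multiplicity of d in the factorizations that are counted. *)
Lemma sum_multiplicity (R : pzRingType) P d n l :
  (2 <= n)%N -> (2 <= d)%N -> (1 <= l)%N ->
  \sum_(1 <= i < n.+1 | (d ^ i %| n)%N) \sum_(1 <= j < l.+1)
    (-1) ^+ j.+1 * ('C(i, j))%:R
    * (count_factorization (fun s => P (s + i)%N) (l - j) (n %/ d ^ i))%:R =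
  \sum_(m <- factorization_fset n) (m d)%:R * (P (nb_parts m) && (nb_values m == l))%:R
  :> R.
Proof.
move=> n2 d2 l0; have n0 := ltnW n2.
pose c i j (m : {mset nat}) : R := (-1) ^+ j.+1 * 'C(i, j)%:R
  * (P (nb_parts m) && (nb_values (m `\` msetn i d) == l - j)%N)%:R.
transitivity (\sum_(1 <= i < n.+1 | (d ^ i %| n)%N)
    \sum_(m <- factorization_fset n | (i <= m d)%N) \sum_(1 <= j < l.+1) c i j m).
  rewrite big_nat_cond [RHS]big_nat_cond; apply: eq_bigr => i /andP[/andP[i0 _] dn].
  rewrite -big_factorization_fset_div// exchange_big/=; apply: eq_bigr => j _.
  rewrite /count_factorization natr_sum mulr_sumr; apply: eq_bigr => m _.
  by rewrite /c nb_parts_msetD_msetn msetDKBC.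
rewrite (exchange_big_dep predT)//=; apply: eq_big_seq => m /factorization_fsetP-/(_ n0) mn.
have v0 : (0 < nb_values m)%N.
  rewrite lt0n; apply/eqP => /nb_values_eq0 m0.
  by move: mn n2; rewrite m0 => /factorizations_mset0->.
have mdn : (d ^ m d %| n)%N := factorizations_exp_dvd _ _ d mn.
have mdlt : (m d <= n)%N.
  by rewrite (leq_trans (ltnW (ltn_expl _ d2)))// dvdn_leq.
(* d ^ m d divides n, so the conditions on i reduce to i <= m d. *)
transitivity (\sum_(1 <= i < (m d).+1) \sum_(1 <= j < l.+1) c i j m).
  rewrite [RHS](big_nat_widen _ _ n.+1)//; apply: eq_bigl => i /=.
  rewrite ltnS andb_idl// => /(dvdn_exp2l d) di; exact: dvdn_trans di mdn.
have -> : \sum_(1 <= i < (m d).+1) \sum_(1 <= j < l.+1) c i j m =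
  (P (nb_parts m))%:R * \sum_(1 <= i < (m d).+1) \sum_(1 <= j < l.+1)
    (-1) ^+ j.+1 * 'C(i, j)%:R * (nb_values m - (i == m d) == l - j)%N%:R.
  rewrite mulr_sumr; apply: eq_big_nat => i im; rewrite mulr_sumr.
  apply: eq_bigr => j _; rewrite /c nb_values_msetB_msetn//.
  by case: (P _); rewrite ?mul1r ?mul0r ?mulr0.
rewrite sum_bin_multiplicity//.
by case: (P _); rewrite ?mul1r ?mul0r ?mulr0.
Qed.

(** Both recurrences at once: P is the condition on the number of parts, and
adjoining i copies of d shifts it by i. *)
Lemma count_factorization_ln (R : realType) P n l : (2 <= n)%N -> (1 <= l)%N ->
  (count_factorization P l n)%:R * ln (n%:R : R) =
  \sum_(2 <= d < n.+1) \sum_(1 <= i < n.+1 | (d ^ i %| n)%N)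
    \sum_(1 <= j < l.+1)
      (-1) ^+ j.+1 * ('C(i, j))%:R
      * (count_factorization (fun s => P (s + i)%N) (l - j) (n %/ d ^ i))%:R
      * ln (d%:R : R).
Proof.
move=> n2 l0; have n0 := ltnW n2.
transitivity (\sum_(2 <= d < n.+1) (\sum_(m <- factorization_fset n)
    (m d)%:R * (P (nb_parts m) && (nb_values m == l))%:R) * ln (d%:R : R)).
  under [RHS]eq_bigr do rewrite mulr_suml.
  rewrite exchange_big/= /count_factorization natr_sum mulr_suml.
  apply: eq_big_seq => m /factorization_fsetP-/(_ n0) mn.
  rewrite (ln_factorization _ _ _ n0 mn) mulr_sumr.
  by apply: eq_bigr => d _; rewrite mulrA [_ * (m d)%:R]mulrC.
apply: eq_big_nat => d /andP[d2 _]; rewrite -sum_multiplicity// mulr_suml.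
by apply: eq_bigr => i _; rewrite mulr_suml.
Qed.

Theorem theorem8 (R : realType) (n k l : nat)
    (hn : (2 <= n)%N) (hk : (1 <= k)%N) (hl : (1 <= l)%N) :
  (f k%:Z l%:Z n)%:R * ln (n%:R : R) =
    \sum_(2 <= d < n.+1) \sum_(1 <= i < n.+1 | (d ^ i %| n)%N)
      \sum_(1 <= j < l.+1)
        (-1) ^+ j.+1 * ('C(i, j))%:R
        * (f (k%:Z - i%:Z) (l%:Z - j%:Z) (n %/ d ^ i)%N)%:R * ln (d%:R : R)
  /\
  (h l n)%:R * ln (n%:R : R) =
    \sum_(2 <= d < n.+1) \sum_(1 <= i < n.+1 | (d ^ i %| n)%N)
      \sum_(1 <= j < l.+1)
        (-1) ^+ j.+1 * ('C(i, j))%:R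
        * (h (l - j)%N (n %/ d ^ i)%N)%:R * ln (d%:R : R).
Proof.
have n0 := ltnW hn.
have q0 d i : (2 <= d)%N -> (d ^ i %| n)%N -> (0 < n %/ d ^ i)%N.
  by move=> d2 dn; rewrite divn_gt0 ?expn_gt0 ?(leq_trans _ d2)// dvdn_leq.
split.
  rewrite f_count_factorization// count_factorization_ln//.
  apply: eq_big_nat => d /andP[d2 _]; apply: eq_bigr => i dn.
  apply: eq_big_nat => j /andP[_ jl].
  rewrite (subzn (jl : (j <= l)%N)) f_count_factorization ?q0//.
  congr (_ * _%:R * _); apply: eq_bigr => m _.
  by rewrite PoszD -subr_eq opprK.
rewrite h_count_factorization// count_factorization_ln//.
apply: eq_big_nat => d /andP[d2 _]; apply: eq_bigr => i dn.
by apply: eq_bigr => j _; rewrite h_count_factorization ?q0.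
Qed.
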